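(* Let $r>0$, $\lambda\in\mathbb{R}$, and consider the system $$\dot x(t)=F(\lambda,x_t),$$ where $x_t(\theta)=x(t+\theta)$ for $\theta\in[-r,0]$ and $F:\mathbb{R}\times C([-r,0],\mathbb{R}^n)\to\mathbb{R}^n$ satisfies $F(\lambda,0)=0$ for all $\lambda\in\mathbb{R}$. Assume that for $\lambda=\lambda_0$ a Hopf bifurcation of the origin of this system takes place. Write $\Delta(\mu,\lambda)=0$ for the characteristic equation of the linearization of the system at the origin, and denote by $\mu_0=\mu_0(\lambda)$ the root, $\Delta(\mu_0(\lambda),\lambda)=0$, that satisfies $\mu_0(\lambda_0)=i\omega_0$ for some $\omega_0\in\mathbb{R}$. Assume furthermore that for $\lambda<\lambda_0$ a periodic solution $\overline{x}_\lambda$ of the system exists. Then: (i) the Hopf bifurcation is subcritical if $\mathrm{Re}\,\mu_0(\lambda)<0$ for $\lambda<\lambda_0$ in a neighbourhood of $\lambda_0$; (ii) the Hopf bifurcation is supercritical if $\mathrm{Re}\,\mu_0(\lambda)>0$ for $\lambda<\lambda_0$ in a neighbourhood of $\lambda_0$.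
   Context: A Hopf bifurcation of an equilibrium occurs if there is exactly one pair of non-zero roots of the characteristic equation on the imaginary axis, and this pair of roots crosses the axis with non-zero speed as the parameter is varied. The Hopf bifurcation is called subcritical if the periodic solution arising from it exists for parameter values $\lambda$ for which the critical root $\mu_0(\lambda)$ is in the left half of the complex plane, and supercritical if it exists for parameter values for which $\mu_0(\lambda)$ is in the right half of the complex plane.
   Formalization: The periodic solution assumed for λ<λ0 is required to be the one arising from the Hopf bifurcation (non-constant, amplitude tending to 0, period tending to 2π/|ω0| as λ→λ0), since an unrelated periodic solution would make the claim false; F(λ,·) is assumed differentiable at 0. *)

(* Defs.v *)
From HB Require Import structures.
From mathcomp Require Import all_boot all_order all_algebra.
From mathcomp Require Import all_classical all_reals all_analysis.
From mathcomp.real_closed Require Import complex.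

Set Implicit Arguments.
Unset Strict Implicit.
Unset Printing Implicit Defensive.
Import Order.TTheory GRing.Theory Num.Theory.
Import numFieldNormedType.Exports.
Local Open Scope classical_set_scope.
Local Open Scope ring_scope.
Local Open Scope complex_scope.

(* The Banach space C([-r,0], R^n) with the supremum norm (R^n carries the
   max norm of MathComp-Analysis, which is equivalent to any other). *)
Section ContinuousSpace.
Context {R : realType}.

Definition delay_itv (r : R) : set R := `[- r, 0]%classic.

Definition cspace (r : R) (n : nat) : Type :=
  continuousType (delay_itv r) 'cV[R]_n.

HB.instance Definition _ r n := Choice.on (cspace r n).

Context {r : R} {n : nat}.
Local Notation C := (cspace r n).
Implicit Types phi psi : C.

Lemma cspace_cts phi : continuous (phi : delay_itv r -> 'cV[R]_n).
Proof. exact: cts_fun. Qed.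

Lemma cspaceP phi psi :
  (forall th : delay_itv r, phi th = psi th) -> phi = psi.
Proof. by move=> H; apply/continuousEP. Qed.

Definition cspace_mk (f : delay_itv r -> 'cV[R]_n) (cf : continuous f) : C :=
  mkcts cf.

Lemma cst0_cts : continuous (fun _ : delay_itv r => 0 : 'cV[R]_n).
Proof. exact: cst_continuous. Qed.

Lemma opp_cts phi : continuous (fun th : delay_itv r => - phi th).
Proof. by move=> x; have /continuousN := @cspace_cts phi x. Qed.

Lemma add_cts phi psi : continuous (fun th : delay_itv r => phi th + psi th).
Proof. move=> x; exact: (continuousD (@cspace_cts phi x) (@cspace_cts psi x)). Qed.

Lemma scale_cts (a : R) phi : continuous (fun th : delay_itv r => a *: phi th).
Proof. move=> x; exact: (continuousZl_tmp (k := a) (@cspace_cts phi x)). Qed.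

Definition cspace0 : C := cspace_mk cst0_cts.
Definition cspace_opp phi : C := cspace_mk (@opp_cts phi).
Definition cspace_add phi psi : C := cspace_mk (@add_cts phi psi).
Definition cspace_scale (a : R) phi : C := cspace_mk (@scale_cts a phi).

Lemma cspace_addA : associative cspace_add.
Proof. by move=> f g h; apply: cspaceP => th /=; rewrite /mkcts addrA. Qed.
Lemma cspace_addC : commutative cspace_add.
Proof. by move=> f g; apply: cspaceP => th /=; rewrite /mkcts addrC. Qed.
Lemma cspace_add0 : left_id cspace0 cspace_add.
Proof. by move=> f; apply: cspaceP => th /=; rewrite /mkcts add0r. Qed.
Lemma cspace_addN : left_inverse cspace0 cspace_opp cspace_add.
Proof. by move=> f; apply: cspaceP => th /=; rewrite /mkcts addNr. Qed.

HB.instance Definition _ := GRing.isZmodule.Build C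
  cspace_addA cspace_addC cspace_add0 cspace_addN.

Lemma cspace_scaleA (a b : R) phi :
  cspace_scale a (cspace_scale b phi) = cspace_scale (a * b) phi.
Proof. by apply: cspaceP => th /=; rewrite /mkcts scalerA. Qed.
Lemma cspace_scale1 : left_id 1 cspace_scale.
Proof. by move=> f; apply: cspaceP => th /=; rewrite /mkcts scale1r. Qed.
Lemma cspace_scaleDr : right_distributive cspace_scale +%R.
Proof. by move=> a f g; apply: cspaceP => th /=; rewrite /mkcts scalerDr. Qed.
Lemma cspace_scaleDl phi : {morph cspace_scale^~ phi : a b / a + b}.
Proof. by move=> a b; apply: cspaceP => th /=; rewrite /mkcts scalerDl. Qed.

HB.instance Definition _ := GRing.Zmodule_isLmodule.Build R C
  cspace_scaleA cspace_scale1 cspace_scaleDr cspace_scaleDl.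

Lemma cspace_addE phi psi (th : delay_itv r) : (phi + psi) th = phi th + psi th.
Proof. by []. Qed.
Lemma cspace_scaleE (a : R) phi (th : delay_itv r) : (a *: phi) th = a *: phi th.
Proof. by []. Qed.

Definition sup_norm phi : R :=
  sup [set `|phi th| | th in [set: delay_itv r]].

Lemma sup_norm_ubound phi :
  has_ubound [set `|phi th| | th in [set: delay_itv r]].
Proof.
have phiE : valL_ 0 phi \o set_val = phi.
  by apply/funext => th; exact: (congr1 (@^~ th) (valLK 0 phi)).
have /compact_bounded [M [_ HM]] : compact (valL_ 0 phi @` delay_itv r).
  apply: continuous_compact; last exact: segment_compact.
  by apply/subspace_valL_continuousP'; exact: cspace_cts.
exists (M + 1) => _ [th _ <-].
apply: HM; first by rewrite ltrDl.
by exists (set_val th); [exact: set_valP | rewrite -[in RHS]phiE].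
Qed.

Lemma le_sup_norm phi (th : delay_itv r) : `|phi th| <= sup_norm phi.
Proof. by apply: ub_le_sup; [exact: sup_norm_ubound | exists th]. Qed.

Lemma sup_norm_le phi (M : R) : 0 <= M ->
  (forall th : delay_itv r, `|phi th| <= M) -> sup_norm phi <= M.
Proof.
move=> M0 H; rewrite /sup_norm.
have [->|/set0P ne] := eqVneq [set `|phi th| | th in [set: delay_itv r]] set0.
  by rewrite sup0.
by apply: ge_sup => // _ [th _ <-].
Qed.

Lemma sup_norm_ge0 phi : 0 <= sup_norm phi.
Proof.
have [E|/set0P [_ [th _ _]]] :=
    eqVneq [set `|phi th| | th in [set: delay_itv r]] set0.
  by rewrite /sup_norm E sup0.
exact: le_trans (le_sup_norm phi th).
Qed.

Lemma sup_normD phi psi : sup_norm (phi + psi) <= sup_norm phi + sup_norm psi.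
Proof.
apply: sup_norm_le => [|th]; first by rewrite addr_ge0 ?sup_norm_ge0.
by rewrite cspace_addE (le_trans (ler_normD _ _)) // lerD ?le_sup_norm.
Qed.

Lemma sup_normZ (a : R) phi : sup_norm (a *: phi) = `|a| * sup_norm phi.
Proof.
have leZ b f : sup_norm (b *: f) <= `|b| * sup_norm f.
  apply: sup_norm_le => [|th]; first by rewrite mulr_ge0 ?sup_norm_ge0.
  by rewrite cspace_scaleE normrZ ler_wpM2l // le_sup_norm.
apply/eqP; rewrite eq_le leZ /=.
have [->|a0] := eqVneq a 0; first by rewrite normr0 mul0r sup_norm_ge0.
have := leZ a^-1 (a *: phi).
rewrite scalerA mulVf // scale1r normfV => H.
by rewrite -ler_pdivlMl ?normr_gt0.
Qed.

Lemma sup_norm0_eq0 phi : sup_norm phi = 0 -> phi = 0.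
Proof.
move=> H; apply: cspaceP => th; apply/eqP; rewrite -normr_le0 -H.
exact: le_sup_norm.
Qed.

HB.instance Definition _ := Lmodule_isNormed.Build R C
  sup_normD sup_normZ sup_norm0_eq0.

Lemma restrict_cts (f : R -> 'cV[R]_n) (cf : continuous f) :
  continuous (fun th : delay_itv r => f (set_val th)).
Proof.
move=> th; apply: continuous_comp; last exact: cf.
exact: initial_continuous.
Qed.

Definition crestrict (f : R -> 'cV[R]_n) (cf : continuous f) : C :=
  cspace_mk (@restrict_cts f cf).

End ContinuousSpace.

Section DelayEquation.
Context {R : realType}.

Lemma shift_cts n (x : R -> 'cV[R]_n) (cx : continuous x) (t : R) :
  continuous (fun th : R => x (t + th)).
Proof.
move=> th; apply: continuous_comp; last exact: cx.
by apply: cvgD; [exact: cvg_cst | exact: cvg_id].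
Qed.

(* x_t(theta) = x(t + theta) for theta in [-r, 0] *)
Definition history (r : R) n (x : R -> 'cV[R]_n) (cx : continuous x) (t : R) :
  cspace r n := crestrict (@shift_cts n x cx t).

Context {r : R} {n : nat}.
Implicit Types (F : R -> cspace r n -> 'cV[R]_n) (lam : R) (mu : R[i]).

Definition is_solution F lam (x : R -> 'cV[R]_n) : Prop :=
  exists cx : continuous x,
    forall t : R, is_derive t 1 x (F lam (history r cx t)).

(* Equilibria, which are trivially periodic, are excluded. *)
Definition periodic_solution F lam (x : R -> 'cV[R]_n) (p : R) : Prop :=
  [/\ is_solution F lam x, 0 < p, periodic x p & exists s t, x s != x t].

(* Real and imaginary parts of theta |-> e^(mu theta) e_j, where
   e^(mu theta) = e^(Re mu theta) (cos (Im mu theta) + i sin (Im mu theta)). *)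
Definition exp_re mu (j : 'I_n) (th : R) : 'cV[R]_n :=
  (expR (complex.Re mu * th) * cos (complex.Im mu * th)) *: delta_mx j 0.
Definition exp_im mu (j : 'I_n) (th : R) : 'cV[R]_n :=
  (expR (complex.Re mu * th) * sin (complex.Im mu * th)) *: delta_mx j 0.

Lemma exp_re_cts mu j : continuous (exp_re mu j).
Proof.
have cM (a : R) : continuous (fun th : R => a * th) by exact: mulrl_continuous.
move=> th; apply: (@continuousZr_tmp _ _ _
  (fun th => expR (complex.Re mu * th) * cos (complex.Im mu * th))).
apply: (@continuousM _ _ (fun th => expR _) (fun th => cos _)).
  by apply: (continuous_comp (cM _ th)); exact: continuous_expR.
by apply: (continuous_comp (cM _ th)); exact: continuous_cos.
Qed.

Lemma exp_im_cts mu j : continuous (exp_im mu j).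
Proof.
have cM (a : R) : continuous (fun th : R => a * th) by exact: mulrl_continuous.
move=> th; apply: (@continuousZr_tmp _ _ _
  (fun th => expR (complex.Re mu * th) * sin (complex.Im mu * th))).
apply: (@continuousM _ _ (fun th => expR _) (fun th => sin _)).
  by apply: (continuous_comp (cM _ th)); exact: continuous_expR.
by apply: (continuous_comp (cM _ th)); exact: continuous_sin.
Qed.

(* The characteristic function det (mu I - L (e^(mu .) I)), where the
   linearization L = D_phi F(lam, 0) acts on complex-valued functions by
   L (f + i g) = L f + i L g. *)
Definition char_matrix F lam mu : 'M[R[i]]_n :=
  mu%:M - \matrix_(i, j)
    ('d (F lam) 0 (crestrict (@exp_re_cts mu j)) i 0
     +i* 'd (F lam) 0 (crestrict (@exp_im_cts mu j)) i 0).

Definition char_fun F mu lam : R[i] := \det (char_matrix F lam mu).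

(* [mu0] is the branch of roots carrying the critical pair. Since [F] is
   real, the conjugate root crosses with the same speed. *)
Definition hopf_bifurcation F (lam0 : R) (mu0 : R -> R[i]) : Prop :=
  exists omega0 : R,
  [/\ omega0 != 0 /\ mu0 lam0 = 0 +i* omega0,
      (forall mu, complex.Re mu = 0 -> mu != 0 ->
         (char_fun F mu lam0 = 0 <-> mu = 0 +i* omega0 \/ mu = 0 -i* omega0)),
      (\forall lam \near lam0, char_fun F (mu0 lam) lam = 0),
      derivable (fun lam => complex.Re (mu0 lam)) lam0 1 /\
      derivable (fun lam => complex.Im (mu0 lam)) lam0 1 &
      derive1 (fun lam => complex.Re (mu0 lam)) lam0 != 0].

(* The periodic solutions [x lam], for the parameters [lam] in [D] near
   [lam0], arise from the Hopf bifurcation at [lam0]: their amplitude tends to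
   0 and their period to 2 pi / |omega0| as [lam] tends to [lam0] within [D],
   where i omega0 = mu0(lam0). *)
Definition arising_periodic_solutions F (lam0 : R) (mu0 : R -> R[i])
    (D : set R) (x : R -> R -> 'cV[R]_n) : Prop :=
  exists p : R -> R,
  [/\ (\forall lam \near within D (nbhs lam0),
         periodic_solution F lam (x lam) (p lam)),
      (forall e : R, 0 < e ->
         \forall lam \near within D (nbhs lam0), forall t, `|x lam t| < e) &
      p lam @[lam --> within D (nbhs lam0)] -->
        2 * pi / `|complex.Im (mu0 lam0)|].

(* By the non-zero crossing speed, the set of parameters with mu0(lam) in the
   left (resp. right) half plane is, near lam0, exactly one of the two sides of
   lam0; the requirements below are therefore never vacuous. *)
Definition subcritical F (lam0 : R) (mu0 : R -> R[i]) : Prop :=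
  hopf_bifurcation F lam0 mu0 /\
  exists x, arising_periodic_solutions F lam0 mu0
              [set lam | complex.Re (mu0 lam) < 0] x.

Definition supercritical F (lam0 : R) (mu0 : R -> R[i]) : Prop :=
  hopf_bifurcation F lam0 mu0 /\
  exists x, arising_periodic_solutions F lam0 mu0
              [set lam | 0 < complex.Re (mu0 lam)] x.

End DelayEquation.

(* Main.v *)
Require Import Defs.
From mathcomp Require Import all_boot all_order all_algebra.
From mathcomp Require Import all_classical all_reals all_analysis.
From mathcomp.real_closed Require Import complex.

Set Implicit Arguments.
Unset Strict Implicit.
Unset Printing Implicit Defensive.
Import Order.TTheory GRing.Theory Num.Theory.
Import numFieldNormedType.Exports.
Local Open Scope classical_set_scope.
Local Open Scope ring_scope.
Local Open Scope complex_scope.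

(** The periodic solutions are given on the side lam < lam0, whereas sub- and
    supercriticality ask for them on the side where Re mu0 has a prescribed
    sign.  The crossing speed makes these the same side.  The function
    lam |-> Re (mu0 lam) vanishes at lam0 with non-zero derivative, so near lam0
    it has opposite strict signs on the two sides of lam0
    ([near_lt_of_derive1_gt0]).  Its sign on the left therefore determines its
    sign on the right: if Re mu0 < 0 on the left, then near lam0 the condition
    Re mu0 < 0 forces lam < lam0 ([near_lt_of_left_lt]), and the given family
    is also a family over the parameters with Re mu0 < 0
    ([arising_periodic_solutions_sub]).  The supercritical case is the
    same argument applied to - Re mu0. *)

(** The difference quotient is eventually positive, so f x - f a and x - a have
    the same sign. *)
Lemma near_lt_of_derive1_gt0 (R : realType) (f : R -> R) (a : R) :
  derivable f a 1 -> 0 < derive1 f a ->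
  \forall x \near a, (f x < f a) = (x < a).
Proof.
move=> df; rewrite derive1E => f'gt0.
have quot_gt0 : \forall h \near 0^', 0 < h^-1 *: (f (h *: 1 + a) - f a).
  exact: (cvgr_gt _ df).
have shift0 : x - a @[x --> a] --> (0 : R).
  by rewrite -(subrr a); apply: cvgB; [exact: cvg_id | exact: cvg_cst].
have : \forall x \near a, x - a != 0 ->
    0 < (x - a)^-1 *: (f ((x - a) *: 1 + a) - f a) by exact: shift0 quot_gt0.
apply: filterS => x quot.
have [->|xa] := eqVneq x a; first by rewrite !ltxx.
have := quot; rewrite subr_eq0 => /(_ xa).
rewrite /GRing.scale/= mulr1 subrK => q.
have [xlta|altx|xeqa] := ltgtP x a; last by rewrite xeqa eqxx in xa.
- by move: q; rewrite nmulr_rgt0 ?invr_lt0 ?subr_lt0.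
- move: q; rewrite pmulr_rgt0 ?invr_gt0 ?subr_gt0 // => /ltW.
  by rewrite leNgt => /negbTE.
Qed.

(** A negative derivative would make f exceed f a on the left, so the
    derivative is positive and the values below f a occur only on the left. *)
Lemma near_lt_of_left_lt (R : realType) (f : R -> R) (a : R) :
  derivable f a 1 -> derive1 f a != 0 ->
  (\forall x \near a^'-, f x < f a) ->
  \forall x \near a, f x < f a -> x < a.
Proof.
move=> df f'0 left_lt.
have [f'lt0|f'gt0|f'eq0] := ltgtP (derive1 f a) 0;
  last by rewrite f'eq0 eqxx in f'0.
- have : 0 < derive1 (- f) a by rewrite derive1E deriveN // -derive1E oppr_gt0.
  move=> /(near_lt_of_derive1_gt0 (derivableN df)) opp_lt.
  have [x [] /[swap]] : exists x, f x < f a /\ f a < f x.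
    apply: (@filter_ex _ a^'-); apply: filterI => //.
    apply: filterS opp_lt => x /= + xa.
    by rewrite xa /= ltrN2.
  by move=> /lt_trans /[apply]; rewrite ltxx.
- by apply: filterS (near_lt_of_derive1_gt0 df f'gt0) => x ->.
Qed.

(** Every requirement on the family holds for parameters of D close to lam0, so
    only the germ of D at lam0 matters. *)
Lemma arising_periodic_solutions_sub (R : realType) (r : R) (n : nat)
  (F : R -> cspace r n -> 'cV[R]_n) (lam0 : R) (mu0 : R -> R[i])
  (D E : set R) (x : R -> R -> 'cV[R]_n) :
  (\forall lam \near lam0, E lam -> D lam) ->
  arising_periodic_solutions F lam0 mu0 D x ->
  arising_periodic_solutions F lam0 mu0 E x.
Proof.
move=> ED [p [sol amp per]].
have finer : within D (nbhs lam0) `<=` within E (nbhs lam0).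
  by move=> S; apply: filterS2 ED => lam ED_lam DS /ED_lam /DS.
exists p; split; [exact: finer | by move=> e /amp /finer | ].
by move=> U /per /finer.
Qed.

Theorem theorem1p3 (R : realType) (r : R) (n : nat)
  (F : R -> cspace r n -> 'cV[R]_n)
  (lam0 omega0 : R) (mu0 : R -> R[i]) (xbar : R -> R -> 'cV[R]_n)
  (hr : 0 < r)
  (hF0 : forall lam, F lam 0 = 0)
  (hFdiff : forall lam, differentiable (F lam) 0)
  (hHopf : hopf_bifurcation F lam0 mu0)
  (hmu0 : mu0 lam0 = 0 +i* omega0)
  (hxbar : arising_periodic_solutions F lam0 mu0 [set lam | lam < lam0] xbar) :
  ((\forall lam \near lam0^'-, complex.Re (mu0 lam) < 0) ->
     subcritical F lam0 mu0) /\
  ((\forall lam \near lam0^'-, 0 < complex.Re (mu0 lam)) ->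
     supercritical F lam0 mu0).
Proof.
have [_ [_ _ _ [dRe _] speed]] := hHopf.
have Re0 : complex.Re (mu0 lam0) = 0 by rewrite hmu0.
split=> left_sign; split=> //; exists xbar;
  apply: arising_periodic_solutions_sub hxbar.
- have := near_lt_of_left_lt dRe speed.
  by rewrite Re0; apply.
- pose g lam := - complex.Re (mu0 lam).
  have g'0 : derive1 g lam0 != 0.
    by rewrite derive1E deriveN // -derive1E oppr_eq0.
  have := @near_lt_of_left_lt _ g _ (derivableN dRe) g'0.
  have -> : g lam0 = 0 by rewrite /g Re0 oppr0.
  move=> left_lt.
  have /left_lt : \forall lam \near lam0^'-, g lam < 0.
    by apply: filterS left_sign => lam; rewrite /g oppr_lt0.
  by apply: filterS => lam + Re_gt0; apply; rewrite /g oppr_lt0.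
Qed.
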